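(* Let $n$ be an odd integer and let $k$ be an integer with $1 \le k \le n-1$. For each positive divisor $d$ of $n$, let $\alpha_d^{k}$ be the number of $\sigma$-orbits contained in $E_{\rm e}^{-}(n,k)$ whose period equals $d(n-k)$, and let $\beta_d^{k}$ be the number of $\sigma$-orbits contained in $E_{\rm e}^{+}(n,k)$ whose period equals $d(k+1)$. Then \[ B_{n-1,k-1} = \sum_{d\mid n} d\,\alpha_d^{k},\qquad B_{n-1,k} = \sum_{d\mid n} d\,\beta_d^{k},\qquad B_{n,k} = \sum_{d\mid n} d\{(n-k)\alpha_d^{k} + (k+1)\beta_d^{k}\}, \] where the sums run over the positive divisors $d$ of $n$.
   Context: Permutations of $[m]=\{1,\dots,m\}$ are written as words $a_1a_2\cdots a_m$. An ascent is an index $i$ ($1\le i\le m-1$) with $a_i<a_{i+1}$. An inversion is a pair $(i,j)$ with $1\le i<j\le m$ and $a_i>a_j$; ${\rm inv}(A)$ is the number of inversions of $A$. For any integer $k$, $E(m,k)$ is the set of permutations of $[m]$ with exactly $k$ ascents (empty if $k<0$ or $k>m-1$); $E_{\rm e}(m,k)$ and $E_{\rm o}(m,k)$ are its subsets of permutations with an even, respectively odd, number of inversions; $B_{m,k}=|E_{\rm e}(m,k)|$, $C_{m,k}=|E_{\rm o}(m,k)|$. For $n\ge 2$, $E_{\rm e}^{-}(n,k)$ (resp. $E_{\rm e}^{+}(n,k)$) is the set of $a_1\cdots a_n\in E_{\rm e}(n,k)$ with $a_1<a_n$ (resp. $a_1>a_n$). The operator $\sigma$ on permutations $A=a_1\cdots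 a_n$ of $[n]$ is defined by: if $a_i=n$ for some $2\le i\le n-1$, then $\sigma(A)=b_1\cdots b_n$ with $b_j=a_j+1$ for $j\ne i$ and $b_i=1$; if $a_n=n$, then $\sigma(A)=1(a_1+1)(a_2+1)\cdots(a_{n-1}+1)$; if $a_1=n$, then $\sigma(A)=(a_2+1)(a_3+1)\cdots(a_n+1)1$. The map $\sigma$ is a bijection on the permutations of $[n]$; the period $\pi(A)$ of $A$ is the least positive integer $\ell$ with $\sigma^{\ell}A=A$, and the orbit of $A$ is $\{\sigma A,\sigma^2A,\dots,\sigma^{\pi(A)}A\}$. When $n$ is odd, $\sigma$ maps each of $E_{\rm e}^{-}(n,k)$ and $E_{\rm e}^{+}(n,k)$ into itself, so each of these sets is a union of orbits. *)

(* Defs.v *)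
From mathcomp Require Import all_boot all_fingroup.

Set Implicit Arguments.
Unset Strict Implicit.
Unset Printing Implicit Defensive.

(* A permutation of [m] is an element of 'S_m; positions and values in 'I_m
   are shifted down by one, so that its word a_1 ... a_m has a_i = letter A i
   for 1 <= i <= m. *)
Definition letter m (A : 'S_m) (i : nat) : nat :=
  nth 0 [seq (val (A j)).+1 | j : 'I_m] i.-1.

Definition ascents m (A : 'S_m) : nat :=
  #|[set i : 'I_m.-1 | letter A i.+1 < letter A i.+2]|.

Definition inv m (A : 'S_m) : nat :=
  #|[set p : 'I_m * 'I_m | (p.1 < p.2) && (A p.2 < A p.1)]|.

Definition E m k : {set 'S_m} := [set A | ascents A == k].
Definition Ee m k : {set 'S_m} := [set A in E m k | ~~ odd (inv A)].
Definition B m k : nat := #|Ee m k|.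

Definition Ee_minus n k : {set 'S_n} :=
  [set A in Ee n k | letter A 1 < letter A n].
Definition Ee_plus n k : {set 'S_n} :=
  [set A in Ee n k | letter A n < letter A 1].

(* [ordS] and [ord_pred] are the cyclic successor and predecessor on 'I_n.
   On values, [ordS] sends the letter a < n to a + 1 and the letter n to 1.
   On positions, it performs the rotation of the word needed when the letter n
   stands at an end:
     a_1 = n : b_j = a_(j+1) + 1 for j < n, and b_n = 1;
     a_n = n : b_1 = 1, and b_j = a_(j-1) + 1 for j > 1.  *)
Definition sigma_fun n (A : 'S_n) (j : 'I_n) : 'I_n :=
  if letter A 1 == n then ordS (A (ordS j))
  else if letter A n == n then ordS (A (ord_pred j))
  else ordS (A j).

Lemma sigma_fun_inj n (A : 'S_n) : injective (sigma_fun A).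
Proof.
move=> i j; rewrite /sigma_fun; case: ifP => _; [|case: ifP => _].
- by move=> /ordS_inj/perm_inj/ordS_inj.
- by move=> /ordS_inj/perm_inj/ord_pred_inj.
- by move=> /ordS_inj/perm_inj.
Qed.

Definition sigma n (A : 'S_n) : 'S_n := perm (@sigma_fun_inj n A).

Lemma letterE m (A : 'S_m) (j : 'I_m) : letter A j.+1 = (A j).+1.
Proof.
rewrite /letter /= (nth_map j) ?size_enum_ord //.
by rewrite nth_ord_enum.
Qed.

Lemma sigmaE n (A : 'S_n) j : sigma A j = sigma_fun A j.
Proof. by rewrite permE. Qed.

Lemma letter_first n (A : 'S_n.+1) : letter A 1 = (A ord0).+1.
Proof. exact: (letterE A ord0). Qed.

Lemma letter_last n (A : 'S_n.+1) : letter A n.+1 = (A ord_max).+1.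
Proof. exact: (letterE A ord_max). Qed.

Lemma ordS_max n : ordS (@ord_max n) = ord0.
Proof. by apply: val_inj; rewrite /= modnn. Qed.

Lemma ord_pred0 n : ord_pred (@ord0 n) = ord_max.
Proof. by rewrite -ordS_max ordSK. Qed.

Lemma sigma_mid n (A : 'S_n.+1) (i : 'I_n.+1) :
  i != ord0 -> i != ord_max -> letter A i.+1 = n.+1 ->
  letter (sigma A) i.+1 = 1 /\
  (forall j : 'I_n.+1, j != i -> letter (sigma A) j.+1 = letter A j.+1 + 1).
Proof.
rewrite letterE => i0 im [Ai].
have ne (l : 'I_n.+1) : l != i -> ((A l).+1 == n.+1) = false.
  by apply: contraNF => /eqP[Al]; apply/eqP/(@perm_inj _ A)/val_inj; rewrite /= Al Ai.
have sE j : sigma A j = ordS (A j).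
  by rewrite sigmaE /sigma_fun letter_first letter_last !ne // eq_sym.
split=> [|j ji]; rewrite !letterE sE /=; first by rewrite Ai modnn.
rewrite addn1 modn_small // ltn_neqAle ltn_ord andbT; exact/negbT/ne.
Qed.

Lemma sigma_last n (A : 'S_n.+1) :
  0 < n -> letter A n.+1 = n.+1 ->
  letter (sigma A) 1 = 1 /\
  (forall j : nat, 0 < j < n.+1 -> letter (sigma A) j.+1 = letter A j + 1).
Proof.
rewrite letter_last => n0 [Am].
have ne (l : 'I_n.+1) : l != ord_max -> ((A l).+1 == n.+1) = false.
  by apply: contraNF => /eqP[Al]; apply/eqP/(@perm_inj _ A)/val_inj; rewrite /= Al Am.
have sE j : sigma A j = ordS (A (ord_pred j)).
  rewrite sigmaE /sigma_fun letter_first letter_last ne ?Am ?eqxx //.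
  by rewrite -val_eqE /= eq_sym -lt0n.
split=> [|[//|j] /andP[_ jn]].
  by rewrite letter_first sE ord_pred0 /= Am modnn.
have jn' : j < n.+1 by apply: ltnW.
rewrite (letterE _ (Ordinal jn)) (letterE _ (Ordinal jn')) sE.
have -> : ord_pred (Ordinal jn) = Ordinal jn'.
  by apply: (can_inj (@ordSK _)); rewrite ord_predK; apply: val_inj; rewrite /= modn_small.
rewrite addn1 /= modn_small // ltn_neqAle ltn_ord andbT; apply/negbT/ne.
by rewrite -val_eqE /= neq_ltn -ltnS jn.
Qed.

Lemma sigma_first n (A : 'S_n.+1) :
  letter A 1 = n.+1 ->
  letter (sigma A) n.+1 = 1 /\
  (forall j : nat, 0 < j < n.+1 -> letter (sigma A) j = letter A j.+1 + 1).
Proof.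
rewrite letter_first => [[A0]].
have ne (l : 'I_n.+1) : l != ord0 -> ((A l).+1 == n.+1) = false.
  by apply: contraNF => /eqP[Al]; apply/eqP/(@perm_inj _ A)/val_inj; rewrite /= Al A0.
have sE j : sigma A j = ordS (A (ordS j)).
  by rewrite sigmaE /sigma_fun letter_first A0 eqxx.
split=> [|[//|j] /andP[_ jn]].
  by rewrite letter_last sE ordS_max /= A0 modnn.
have jn' : j < n.+1 by apply: ltnW.
rewrite (letterE _ (Ordinal jn)) (letterE _ (Ordinal jn')) sE.
have -> : ordS (Ordinal jn') = Ordinal jn.
  by apply: val_inj; rewrite /= modn_small.
by rewrite addn1 /= modn_small // ltn_neqAle ltn_ord andbT; apply/negbT/ne.
Qed.

Lemma sigma_inj n : injective (@sigma n).
Proof.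
case: n => [A B _ | n]; first by apply/permP; case.
suff sep (A B : 'S_n.+1) : sigma A = sigma B ->
    (letter A 1 == n.+1) = (letter B 1 == n.+1) /\
    ((letter A 1 == n.+1) = false ->
     (letter A n.+1 == n.+1) = (letter B n.+1 == n.+1)).
  move=> A B AB; have [e1 e2] := sep _ _ AB; apply/permP => j.
  have {}AB i : sigma_fun A i = sigma_fun B i by rewrite -!sigmaE AB.
  move: AB e2; rewrite /sigma_fun -e1; case: (letter A 1 == _).
    by move=> /(_ (ord_pred j)) /ordS_inj; rewrite ord_predK.
  move=> AB /(_ erefl) e2; move: AB; rewrite -e2; case: (letter A n.+1 == _).
    by move=> /(_ (ordS j)) /ordS_inj; rewrite ordSK.
  by move=> /(_ j) /ordS_inj.
have maxE (C : 'S_n.+1) i : ((C i).+1 == n.+1) = (C i == ord_max) by [].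
rewrite !letter_first !letter_last !maxE => AB.
have {}AB i : sigma_fun A i = sigma_fun B i by rewrite -!sigmaE AB.
move: AB; rewrite /sigma_fun !letter_first !letter_last !maxE.
have no12 (C D : 'S_n.+1) : (C ord0 == ord_max) -> (D ord0 == ord_max) = false ->
    (D ord_max == ord_max) ->
    ~ (forall i, ordS (C (ordS i)) = ordS (D (ord_pred i))).
  move=> /eqP C0 D0 /eqP Dm /(_ ord_max) /ordS_inj; rewrite ordS_max C0 => m0.
  have /perm_inj m1 : D ord_max = D (ord_pred ord_max) by rewrite -m0.
  have m2 : ord0 = ord_max :> 'I_n.+1 by rewrite -[RHS]ord_predK -m1 ordS_max.
  by rewrite m2 Dm eqxx in D0.
have no13 (C D : 'S_n.+1) : (C ord0 == ord_max) -> (D ord_max == ord_max) = false ->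
    ~ (forall i, ordS (C (ordS i)) = ordS (D i)).
  move=> /eqP C0 Dm /(_ ord_max) /ordS_inj; rewrite ordS_max C0 => m.
  by rewrite -m eqxx in Dm.
have no23 (C D : 'S_n.+1) : (C ord_max == ord_max) -> (D ord0 == ord_max) = false ->
    ~ (forall i, ordS (C (ord_pred i)) = ordS (D i)).
  move=> /eqP Cm D0 /(_ ord0) /ordS_inj; rewrite ord_pred0 Cm => m.
  by rewrite -m eqxx in D0.
case: (boolP (A ord0 == _)) => [a1|/negbTE a1];
  case: (boolP (B ord0 == _)) => [b1|/negbTE b1] //.
- case bm: (B ord_max == _) => H; last by case: (no13 _ _ a1 bm H).
  by case: (no12 _ _ a1 b1 bm H).
- case am: (A ord_max == _) => H; last by case: (no13 _ _ b1 am) => i; rewrite H.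
  by case: (no12 _ _ b1 a1 am) => i; rewrite H.
case am: (A ord_max == _); case bm: (B ord_max == _) => H; split=> // _.
- by case: (no23 _ _ am b1 H).
- by case: (no23 _ _ bm a1) => i; rewrite H.
Qed.

Lemma period_ex n (A : 'S_n) : exists l, (0 < l) && (iter l (@sigma n) A == A).
Proof.
exists (fingraph.order (@sigma n) A); rewrite fingraph.order_gt0 /=.
by apply/eqP; apply: iter_order; exact: (@sigma_inj n).
Qed.

Definition period n (A : 'S_n) : nat := ex_minn (period_ex A).

Definition sigma_orbit n (A : 'S_n) : {set 'S_n} :=
  [set iter l.+1 (@sigma n) A | l : 'I_(period A)].

(* All elements of an orbit have the same period. *)
Definition orbits_in n (X : {set 'S_n}) (l : nat) : {set {set 'S_n}} :=
  [set sigma_orbit A | A : 'S_n & (sigma_orbit A \subset X) && (period A == l)].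

Definition alpha n k d : nat := #|orbits_in (Ee_minus n k) (d * (n - k))|.
Definition beta n k d : nat := #|orbits_in (Ee_plus n k) (d * (k + 1))|.

(* Main.v *)
(* Prolong the word of A cyclically.  As long as no end letter equals n, sigma
   shifts the values cyclically; when an end letter equals n it also rotates the
   word, by one place to the right if a_1 < a_n.  The word then starts with the
   letter 1, and the time since its previous such start is the residue mod n of
   the difference of two cyclically adjacent letters of A.  These n residues add
   up to n times the number n - k of cyclic descents, so in n(n - k) steps sigma
   returns to A after exactly n visits to words starting with 1.  Hence an orbit
   with d such words has period d(n - k) and d divides n, and the words starting
   with 1 are counted by B_{n-1,k-1}.  Reversal of words commutes with sigma and
   exchanges a_1 < a_n with a_1 > a_n, which gives the case of k + 1. *)
Require Import Defs.
From mathcomp Require Import all_boot all_fingroup zify.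

Set Implicit Arguments.
Unset Strict Implicit.
Unset Printing Implicit Defensive.

(** * Parity of the inversion number *)

Lemma lift_perm_ex n (A : 'S_n.+1) i : exists s, A = lift_perm i (A i) s.
Proof.
have liftE k : exists l, A (lift i k) = lift (A i) l.
  have ne : A i != A (lift i k) by rewrite (inj_eq perm_inj) neq_lift.
  by have [l -> _] := unlift_some ne; exists l.
(* The default [k] is never reached: by [liftE], [unlift] always succeeds here. *)
pose f k := odflt k (unlift (A i) (A (lift i k))).
have fE k : lift (A i) (f k) = A (lift i k).
  by rewrite /f; have [l ->] := liftE k; rewrite liftK.
have f_inj : injective f.
  by move=> k l fkl; apply/(@lift_inj _ i)/(@perm_inj _ A); rewrite -!fE fkl.
exists (perm f_inj); apply/permP => j.
case: (unliftP i j) => [k ->|->]; last by rewrite lift_perm_id.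
by rewrite lift_perm_lift permE fE.
Qed.

Lemma invE n (A : 'S_n) : Defs.inv A = \sum_(i < n) \sum_(j < n) ((i < j) && (A j < A i)).
Proof.
rewrite /Defs.inv -sum1_card big_mkcond /= pair_big /=.
by apply: eq_bigr => p _; rewrite inE; case: ifP.
Qed.

Lemma lift_lt n (j : 'I_n.+1) (x y : 'I_n) : (lift j x < lift j y) = (x < y).
Proof. by rewrite /= /bump; lia. Qed.

Lemma sum_ltn_ord n m : m <= n -> \sum_(z < n) (z < m) = m.
Proof.
move=> mn; rewrite -[RHS]subn0 -[RHS]muln1 -sum_nat_const_nat big_mkord.
rewrite (big_ord_widen n (fun=> 1) mn) [RHS]big_mkcond.
by apply: eq_bigr => z _; case: ltnP.
Qed.

(** The first letter is inverted with exactly the [j] smaller values, all of which stand to its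
    right. *)
Lemma inv_lift_perm n (j : 'I_n.+1) s : Defs.inv (lift_perm ord0 j s) = j + Defs.inv s.
Proof.
rewrite !invE big_ord_recl big_ord_recl ltnn add0n.
congr (_ + _).
  under eq_bigr => k _ do rewrite lift_perm_id lift_perm_lift /=.
  rewrite (reindex_perm s^-1) /=.
  under eq_bigr => k _ do rewrite permKV.
  rewrite -[RHS](@sum_ltn_ord n) -1?ltnS //.
  by apply: eq_bigr => k _; rewrite /bump; lia.
apply: eq_bigr => k _; rewrite big_ord_recl ltn0 add0n.
by apply: eq_bigr => l _; rewrite !lift_perm_lift !lift_lt.
Qed.

(** Induction by deleting the first letter, whose value changes the inversion count and the sign by
    the same parity. *)
Lemma odd_inv n (A : 'S_n) : odd (Defs.inv A) = A.
Proof.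
elim: n A => [|n IHn] A.
  by rewrite invE big_ord0 (_ : A = 1%g) ?odd_perm1 //; apply/permP; case.
have [s ->] := lift_perm_ex A ord0.
by rewrite inv_lift_perm oddD odd_lift_perm IHn.
Qed.

Lemma in_Ee n k (A : 'S_n) : (A \in Ee n k) = (ascents A == k) && ~~ odd_perm A.
Proof. by rewrite /Ee /E !inE odd_inv. Qed.

(** * Ascents and cyclic descents *)

Lemma ascentsE n (A : 'S_n.+1) :
  ascents A = \sum_(i < n) (A (widen_ord (leqnSn n) i) < A (lift ord0 i)).
Proof.
rewrite /ascents -sum1_card big_mkcond /=; apply: eq_bigr => i _.
rewrite inE (letterE A (widen_ord (leqnSn n) i)) (letterE A (lift ord0 i)).
by rewrite ltnS; case: ifP.
Qed.

(** Since [ord_pred ord0] is [ord_max], the term at 0 compares the two end letters. *)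
Definition cyc_descents n (A : 'S_n) : nat := \sum_(j : 'I_n) (A j < A (ord_pred j)).

Lemma ord_pred_lift0 n (i : 'I_n) : ord_pred (lift ord0 i) = widen_ord (leqnSn n) i.
Proof.
apply: (can_inj (@ordSK _)); rewrite ord_predK; apply: val_inj => /=.
by rewrite modn_small // ltnS.
Qed.

(** Each inner adjacent pair is either an ascent or a descent; the closing pair is a cyclic descent
    exactly when the first letter is below the last. *)
Lemma cyc_descentsE n (A : 'S_n.+1) :
  cyc_descents A + ascents A = (A ord0 < A ord_max) + n.
Proof.
rewrite /cyc_descents big_ord_recl ascentsE ord_pred0 -addnA; congr (_ + _).
rewrite -big_split /= -[RHS]card_ord -sum1_card; apply: eq_bigr => i _.
rewrite ord_pred_lift0.
have : A (widen_ord (leqnSn n) i) != A (lift ord0 i).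
  by rewrite (inj_eq perm_inj) -val_eqE /= /bump; lia.
rewrite -val_eqE /=; lia.
Qed.

Lemma Ee_minusE n k (A : 'S_n.+1) :
  (A \in Ee_minus n.+1 k) = (A \in Ee n.+1 k) && (A ord0 < A ord_max).
Proof. by rewrite inE letter_first letter_last. Qed.

Lemma Ee_plusE n k (A : 'S_n.+1) :
  (A \in Ee_plus n.+1 k) = (A \in Ee n.+1 k) && (A ord_max < A ord0).
Proof. by rewrite inE letter_first letter_last. Qed.

(** * Words with the letter 1 at an end *)

Lemma lift0_perm_ascents n (s : 'S_n.+1) :
  ascents (lift_perm ord0 ord0 s) = (ascents s).+1.
Proof.
rewrite !ascentsE big_ord_recl -[RHS]add1n; congr (_ + _).
  rewrite (_ : widen_ord _ _ = ord0); last exact: val_inj.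
  by rewrite lift_perm_id lift_perm_lift.
apply: eq_bigr => i _.
rewrite (_ : widen_ord _ _ = lift ord0 (widen_ord (leqnSn n) i)); last exact: val_inj.
by rewrite !lift_perm_lift lift_lt.
Qed.

Lemma lift_max_perm_ascents n (s : 'S_n.+1) :
  ascents (lift_perm ord_max ord0 s) = ascents s.
Proof.
rewrite !ascentsE big_ord_recr /=.
rewrite (_ : lift _ _ = ord_max); last exact: val_inj.
rewrite lift_perm_id addn0; apply: eq_bigr => i _.
rewrite (_ : widen_ord _ _ = lift ord_max (widen_ord (leqnSn n) i)); last first.
  by apply: val_inj; rewrite /= /bump; have := ltn_ord i; lia.
rewrite (_ : lift ord0 _ = lift ord_max (lift ord0 i)); last first.
  by apply: val_inj; rewrite /= /bump /=; have := ltn_ord i; lia.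
by rewrite !lift_perm_lift lift_lt.
Qed.

Lemma lift_perm_inj n (i j : 'I_n.+1) : injective (lift_perm i j).
Proof.
move=> s t st; apply/permP => k; apply: (@lift_inj _ j).
by rewrite -!(lift_perm_lift i) st.
Qed.

(** Deleting a leading 1 loses one ascent and no inversion; conversely, a prefixed 1 is
    automatically below the last letter. *)
Lemma card_Ee_minus_canonical n k : 0 < k ->
  #|[set A in Ee_minus n.+2 k | A ord0 == ord0]| = B n.+1 (k - 1).
Proof.
move=> k0; rewrite /B -[RHS](card_imset _ (@lift_perm_inj _ ord0 ord0)).
apply: eq_card => A; rewrite !inE letter_first letter_last.
apply/andP/imsetP => [[/andP[/andP[/eqP asA oA] _] /eqP A0]|[s]].
  have [s sE] := lift_perm_ex A ord0; rewrite A0 in sE.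
  exists s => //; move: asA oA; rewrite in_Ee odd_inv sE lift0_perm_ascents.
  by rewrite odd_lift_perm /= => <- ->; rewrite subn1 eqxx.
rewrite in_Ee => /andP[/eqP ask os] ->.
rewrite odd_inv lift0_perm_ascents ask odd_lift_perm os /= !lift_perm_id.
rewrite subn1 prednK // ?eqxx /= ltnS lt0n; split=> //; apply/negP => /eqP m0.
have /perm_inj : lift_perm ord0 ord0 s ord_max = lift_perm ord0 ord0 s ord0.
  by rewrite lift_perm_id; apply: val_inj.
by [].
Qed.

(** A trailing 1 takes part in no ascent and in [n.+1] inversions, an even number, so deleting it
    preserves parity. *)
Lemma card_Ee_plus_canonical n k : ~~ odd n.+1 ->
  #|[set A in Ee_plus n.+2 k | A ord_max == ord0]| = B n.+1 k.
Proof.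
move=> n_odd; rewrite /B -[RHS](card_imset _ (@lift_perm_inj _ ord_max ord0)).
apply: eq_card => A; rewrite !inE letter_first letter_last.
apply/andP/imsetP => [[/andP[/andP[/eqP asA oA] _] /eqP A0]|[s]].
  have [s sE] := lift_perm_ex A ord_max; rewrite A0 in sE.
  exists s => //; move: asA oA; rewrite in_Ee odd_inv sE lift_max_perm_ascents.
  by rewrite odd_lift_perm (negbTE n_odd) /= => <- ->; rewrite eqxx.
rewrite in_Ee => /andP[/eqP ask os] ->.
rewrite odd_inv lift_max_perm_ascents ask odd_lift_perm (negbTE n_odd) os /= !lift_perm_id.
rewrite !eqxx /= ltnS lt0n; split=> //; apply/negP => /eqP m0.
have /perm_inj : lift_perm ord_max ord0 s ord0 = lift_perm ord_max ord0 s ord_max.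
  by rewrite lift_perm_id; apply: val_inj.
by [].
Qed.

(** * Periods and orbits of [sigma] *)

Lemma period_order n (A : 'S_n) : period A = fingraph.order (@sigma n) A.
Proof.
have s_inj := @sigma_inj n.
rewrite /period; case: ex_minnP => l /andP[l0 /eqP lA] lmin.
apply/eqP; rewrite eqn_leq lmin ?fingraph.order_gt0 ?iter_order ?eqxx //=.
rewrite leqNgt; apply/negP => lt.
have := findex_iter lt; rewrite lA findex0; lia.
Qed.

Lemma period_gt0 n (A : 'S_n) : 0 < period A.
Proof. by rewrite period_order fingraph.order_gt0. Qed.

Lemma iter_period n (A : 'S_n) : iter (period A) (@sigma n) A = A.
Proof. by rewrite period_order iter_order //; apply: sigma_inj. Qed.

Lemma iter_muln_period n (A : 'S_n) q : iter (q * period A) (@sigma n) A = A.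
Proof. by elim: q => // q IHq; rewrite mulSn iterD IHq iter_period. Qed.

Lemma iter_sigma_inj n (A : 'S_n) i j : i < period A -> j < period A ->
  iter i (@sigma n) A = iter j (@sigma n) A -> i = j.
Proof.
rewrite period_order => iA jA ij.
by rewrite -(findex_iter iA) ij findex_iter.
Qed.

Lemma period_dvd n (A : 'S_n) N : iter N (@sigma n) A = A -> period A %| N.
Proof.
move=> NA; rewrite /dvdn; apply/eqP.
apply: (@iter_sigma_inj _ A); rewrite ?ltn_mod ?period_gt0 //.
by rewrite -[RHS]NA [in RHS](divn_eq N (period A)) addnC iterD iter_muln_period.
Qed.

Lemma sigma_orbitP n (A C : 'S_n) : (C \in sigma_orbit A) = fconnect (@sigma n) A C.
Proof.
apply/imsetP/idP => [[l _ ->]|AC]; first exact: fconnect_iter.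
move: (findex_max AC) (iter_findex AC); rewrite -period_order.
case: (findex _ _ _) => [|i] iA <-; last by exists (Ordinal (ltnW iA)).
(* Orbit points are indexed by exponents from 1 to the period, so [A] itself, at index 0, is taken
   at exponent [period A]. *)
have l : (period A).-1 < period A by rewrite prednK.
by exists (Ordinal l) => //=; rewrite -iterS prednK // iter_period.
Qed.

Lemma eq_sigma_orbit n (A C : 'S_n) :
  (sigma_orbit C == sigma_orbit A) = (C \in sigma_orbit A).
Proof.
have symc := fconnect_sym (@sigma_inj n).
apply/eqP/idP => [<-|CA]; first by rewrite sigma_orbitP connect0.
apply/setP => D; rewrite !sigma_orbitP; rewrite sigma_orbitP in CA.
by rewrite (same_connect symc CA).
Qed.

Lemma sum_sigma_orbit n (A : 'S_n) (H : pred 'S_n) :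
  \sum_(C in sigma_orbit A) H C = \sum_(l < period A) H (iter l.+1 (@sigma n) A).
Proof.
rewrite big_imset //= => i j _ _ /sigma_inj/iter_sigma_inj ij.
by apply: val_inj; apply: ij.
Qed.

Lemma card_sigma_orbit n (A : 'S_n) : #|sigma_orbit A| = period A.
Proof. by rewrite -sum1_card (sum_sigma_orbit A xpredT) sum1_card card_ord. Qed.

Lemma sum_iter_period n (A : 'S_n) (H : pred 'S_n) q :
  \sum_(t < q * period A) H (iter t.+1 (@sigma n) A)
  = q * \sum_(C in sigma_orbit A) H C.
Proof.
rewrite sum_sigma_orbit; elim: q => [|q IHq]; first by rewrite big_ord0.
rewrite mulSn big_split_ord /= mulSn -IHq; congr (_ + _).
by apply: eq_bigr => t _; rewrite -iterS addnC -addSn iterD iter_period.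
Qed.

(* Counting the visits to [H] over a time window that is a multiple of every
   period shows that an orbit with [d] points in [H] has period [d * m]. *)
Lemma orbit_hits n (A : 'S_n) (H : pred 'S_n) N m : 0 < N -> 0 < m ->
    iter (N * m) (@sigma n) A = A ->
    \sum_(t < N * m) H (iter t.+1 (@sigma n) A) = N ->
  period A = (\sum_(C in sigma_orbit A) H C) * m
  /\ (\sum_(C in sigma_orbit A) H C) %| N.
Proof.
move=> N0 m0 /period_dvd/dvdnP[q qE]; rewrite qE sum_iter_period.
set c := \sum_(C in _) _ => cq; split; last by rewrite -cq dvdn_mull.
have q0 : 0 < q by case: q cq {qE} => //; lia.
by apply/eqP; rewrite -(eqn_pmul2l q0) -qE -cq mulnA.
Qed.

(** * Sums over orbits, sorted by number of hits *)

Section OrbitCount.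
Variables (n N m : nat) (X : {set 'S_n}) (H : pred 'S_n).
Hypotheses (N_gt0 : 0 < N) (m_gt0 : 0 < m).
Hypothesis X_stable : forall A, A \in X -> sigma A \in X.
Hypothesis X_window : forall A, A \in X -> iter (N * m) (@sigma n) A = A.
Hypothesis X_hits : forall A, A \in X ->
  \sum_(t < N * m) H (iter t.+1 (@sigma n) A) = N.

Lemma sub_sigma_orbit A : (sigma_orbit A \subset X) = (A \in X).
Proof.
apply/subsetP/idP => [|AX C]; first by apply; rewrite -eq_sigma_orbit.
by case/imsetP => l _ ->; elim: l.+1 => //= i; apply: X_stable.
Qed.

(** Weights are summed orbit by orbit. By [orbit_hits], an orbit with [c] hits has size [c * m] with
    [c] dividing [N]; as [m] is positive, it contributes to the term [d = c] only. *)
Lemma sum_orbits (w : 'S_n -> nat) (v : nat -> nat) :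
    (forall A d, A \in X -> period A = d * m -> d %| N ->
       \sum_(C in sigma_orbit A) H C = d -> \sum_(C in sigma_orbit A) w C = v d) ->
  \sum_(A in X) w A = \sum_(d <- divisors N) v d * #|orbits_in X (d * m)|.
Proof.
move=> wv; rewrite (partition_big_imset (@sigma_orbit n)) /=.
have cardE d : #|orbits_in X (d * m)| =
    \sum_(O in [set sigma_orbit A | A in X]) (#|O| == d * m).
  rewrite -sum1_card [RHS]big_mkcond [LHS]big_mkcond /=; apply: eq_bigr => O _.
  have -> : (O \in orbits_in X (d * m)) =
            (O \in [set sigma_orbit A | A in X]) && (#|O| == d * m).
    apply/imsetP/andP => [[A]|[/imsetP[A AX ->]]].
      rewrite inE sub_sigma_orbit => /andP[AX /eqP pA] ->.
      by rewrite card_sigma_orbit pA eqxx imset_f.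
    by rewrite card_sigma_orbit => pA; exists A; rewrite // inE sub_sigma_orbit AX.
  by case: (O \in _); case: eqP.
under [RHS]eq_bigr => d _ do rewrite cardE big_distrr /=.
rewrite exchange_big /=; apply: eq_bigr => _ /imsetP[A AX ->].
have [pA cN] := orbit_hits N_gt0 m_gt0 (X_window AX) (X_hits AX).
set c := \sum_(C in _) H C in pA cN.
rewrite (eq_bigl (mem (sigma_orbit A))) /=; last first.
  move=> C; rewrite eq_sigma_orbit andb_idl // => CA.
  by rewrite -sub_sigma_orbit in AX; apply: (subsetP AX).
rewrite (wv A c AX pA cN erefl).
rewrite (bigD1_seq c) ?divisors_uniq -?dvdn_divisors //=.
rewrite card_sigma_orbit pA eqxx muln1 big1 ?addn0 // => d dc.
by rewrite eqn_pmul2r // eq_sym (negbTE dc) muln0.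
Qed.

Lemma card_hits_orbits :
  #|[set A in X | H A]| = \sum_(d <- divisors N) d * #|orbits_in X (d * m)|.
Proof.
rewrite -(@sum_orbits H id) => [|A d _ _ _ //].
rewrite -sum1_card [LHS]big_mkcond [RHS]big_mkcond; apply: eq_bigr => A _.
by rewrite inE; case: (A \in X); case: (H A).
Qed.

Lemma card_orbits :
  #|X| = \sum_(d <- divisors N) d * (m * #|orbits_in X (d * m)|).
Proof.
rewrite -sum1_card (@sum_orbits _ (muln^~ m)).
  by apply: eq_bigr => d _; rewrite mulnA.
by move=> A d _ pA _ _; rewrite sum1_card card_sigma_orbit.
Qed.

End OrbitCount.

(** * Cyclic gaps between adjacent letters *)

Lemma val_iter_ordS n (x : 'I_n) t : iter t (@ordS n) x = (x + t) %% n :> nat.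
Proof.
elim: t => [|t IHt]; first by rewrite addn0 modn_small.
by rewrite iterS /= IHt -addn1 modnDml addn1 addnS.
Qed.

Lemma iter_ordS_muln n (x : 'I_n) m : iter (n * m) (@ordS n) x = x.
Proof. by apply: val_inj; rewrite /= val_iter_ordS mulnC addnC modnMDl modn_small. Qed.

Lemma iter_ordSK n t : cancel (iter t (@ord_pred n)) (iter t (@ordS n)).
Proof. by elim: t => // t IHt x; rewrite iterSr iterS ord_predK IHt. Qed.

Lemma iter_ord_pred_id n (x : 'I_n) : iter n (@ord_pred n) x = x.
Proof.
rewrite -[LHS](iter_ordS_muln _ 1) muln1; exact: iter_ordSK.
Qed.

(* The residue of [a - b] modulo [n]. *)
Definition cyc_dist n (b a : 'I_n) : nat := if b <= a then a - b else a + n - b.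

Lemma cyc_dist_ordS n (b a : 'I_n) : cyc_dist (ordS b) (ordS a) = cyc_dist b a.
Proof.
have ordSE (x : 'I_n) : ordS x = (if x.+1 == n then 0 else x.+1) :> nat.
  rewrite /=; have := ltn_ord x; case: eqP => [->|]; first by rewrite modnn.
  by move=> *; rewrite modn_small //; lia.
rewrite /cyc_dist !ordSE; have := ltn_ord a; have := ltn_ord b.
by do !case: ifP; lia.
Qed.

Definition gap n (A : 'S_n) (j : 'I_n) : nat := cyc_dist (A (ord_pred j)) (A j).

(** A gap is the difference of adjacent letters, plus [n] exactly at a cyclic descent; the
    differences cancel around the cycle. *)
Lemma sum_gap n (A : 'S_n) : \sum_j gap A j = n * cyc_descents A.
Proof.
have eqA : \sum_j A (ord_pred j) = \sum_j A j :> nat.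
  rewrite [RHS](reindex_inj (@ord_pred_inj n)) /=.
  by apply: eq_bigr.
(* The preceding letters are added to both sides to avoid truncated subtraction. *)
apply/eqP; rewrite -(eqn_add2r (\sum_j A (ord_pred j))) {2}eqA addnC.
rewrite /cyc_descents big_distrr -!big_split; apply/eqP; apply: eq_bigr => j _ /=.
rewrite /gap /cyc_dist; have := ltn_ord (A j); have := ltn_ord (A (ord_pred j)).
by case: (leqP (A (ord_pred j)) (A j)); rewrite ?muln1 ?muln0; lia.
Qed.

Lemma sum_iter_ord_pred n (x : 'I_n) (F : 'I_n -> nat) :
  \sum_(i < n) F (iter i (@ord_pred n) x) = \sum_j F j.
Proof.
have h_inj : injective (fun i : 'I_n => iter i (@ord_pred n) x).
  (* From the common point, [i] and [j] forward steps both lead back to [x], so [i] and [j] agree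
     modulo [n]. *)
  move=> i j ij; apply: val_inj.
  have := val_iter_ordS (iter i (@ord_pred n) x) i.
  rewrite iter_ordSK ij -[in LHS](iter_ordSK j x) val_iter_ordS => /eqP.
  by rewrite eqn_modDl !modn_small // => /eqP.
by rewrite [RHS](reindex_inj h_inj).
Qed.

(** * Dynamics on words whose first letter is below the last *)

Section Minus.
Variables (n : nat) (n_gt0 : 0 < n).
Implicit Type A : 'S_n.+1.

Lemma ord_max_pred_neq : ord_pred (@ord_max n) != ord_max.
Proof.
rewrite -(inj_eq (@ordS_inj _)) ord_predK ordS_max -val_eqE /=; lia.
Qed.

(** The largest letter cannot stand first here, so only the rotation to the right survives. *)
Lemma sigma_minusE A j : A ord0 < A ord_max ->
  sigma A j = ordS (A (if A ord_max == ord_max then ord_pred j else j)).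
Proof.
move=> A0m; rewrite sigmaE /sigma_fun letter_first letter_last.
rewrite ifF; last by have := ltn_ord (A ord_max); lia.
by rewrite -[_.+1 == _.+1]/(A ord_max == ord_max); case: eqP.
Qed.

Definition returned A : bool := A ord0 == ord0.

Lemma val_ordS_neq (x : 'I_n.+1) : x != ord_max -> ordS x = x.+1 :> nat.
Proof.
rewrite -val_eqE /= => xm; rewrite modn_small //; have := ltn_ord x; lia.
Qed.

(** The last clause is a clock: the first letter grows by 1, except at a rotation, where it becomes
    0; the last letter being then maximal, [gap A ord0] equals [(A ord0).+1]. *)
Lemma sigma_minus A : A ord0 < A ord_max ->
  [/\ sigma A ord0 < sigma A ord_max,
      returned (sigma A) = (A ord_max == ord_max)
    & sigma A ord0 + returned (sigma A) * gap A ord0 = (A ord0).+1].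
Proof.
move=> A0m; rewrite /returned !sigma_minusE //; case: eqP => [Am|/eqP Am].
  rewrite ord_pred0 Am ordS_max eqxx mul1n add0n /gap /cyc_dist ord_pred0 Am /=.
  have Ap : A (ord_pred ord_max) != ord_max.
    by rewrite -{2}Am (inj_eq perm_inj) ord_max_pred_neq.
  split=> //; first by have /= -> := val_ordS_neq Ap.
  by move: A0m; rewrite Am /=; case: leqP; lia.
have A0 : A ord0 != ord_max.
  by rewrite -val_eqE /=; have := ltn_ord (A ord_max); lia.
have /= S0 := val_ordS_neq A0; have /= Sm := val_ordS_neq Am.
by rewrite -[_ == ord0]val_eqE /= S0 Sm; split; rewrite ?mul0n ?addn0.
Qed.

Lemma gap_sigma_minus A j : A ord0 < A ord_max ->
  gap (sigma A) j = gap A (if A ord_max == ord_max then ord_pred j else j).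
Proof.
by move=> A0m; rewrite /gap !sigma_minusE // cyc_dist_ordS; case: ifP.
Qed.

(** [sigma] only permutes the gaps, and by [sum_gap] their sum determines the number of cyclic
    descents. *)
Lemma cyc_descents_sigma_minus A : A ord0 < A ord_max ->
  cyc_descents (sigma A) = cyc_descents A.
Proof.
move=> A0m; apply/eqP; rewrite -(@eqn_pmul2l n.+1) // -!sum_gap.
under eq_bigr do rewrite gap_sigma_minus //.
by case: (A ord_max == _); rewrite // [X in _ == X](reindex_inj (@ord_pred_inj _)).
Qed.

Lemma ascents_sigma_minus A : A ord0 < A ord_max ->
  ascents (sigma A) = ascents A.
Proof.
move=> A0m; have [A0m' _ _] := sigma_minus A0m.
have := cyc_descentsE A; have := cyc_descentsE (sigma A).
rewrite cyc_descents_sigma_minus // A0m A0m'; lia.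
Qed.

Section Window.
Variables (A : 'S_n.+1) (A_minus : A ord0 < A ord_max).
Let visits t := \sum_(i < t) returned (iter i.+1 (@sigma _) A).
(** Positions are read backwards from 0, the order in which right rotations bring them to the
    front. *)
Let gap_sum r := \sum_(i < r) gap A (iter i (@ord_pred _) ord0).

(* Until time [t], the word has been rotated once per visit to [returned], and
   the [i]-th rotation is separated from the next one by the [i]-th gap. *)
Lemma iter_sigma_minus t :
  [/\ iter t (@sigma _) A ord0 < iter t (@sigma _) A ord_max,
      forall j, iter t (@sigma _) A j
                = iter t (@ordS _) (A (iter (visits t) (@ord_pred _) j)),
      forall j, gap (iter t (@sigma _) A) j = gap A (iter (visits t) (@ord_pred _) j)
    & iter t (@sigma _) A ord0 + gap_sum (visits t) = t + A ord0].
Proof.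
elim: t => [|t [mt perm_t gap_t time_t]].
  by rewrite /visits /gap_sum !big_ord0 addn0.
have [mS retS timeS] := sigma_minus mt.
have -> : visits t.+1 = visits t + returned (sigma (iter t (@sigma _) A)).
  by rewrite /visits big_ord_recr.
rewrite iterS; split=> //.
- move=> j; rewrite sigma_minusE // retS perm_t.
  by case: eqP => _; rewrite ?addn1 ?addn0 // -iterSr.
- move=> j; rewrite gap_sigma_minus // retS gap_t.
  by case: eqP => _; rewrite ?addn1 ?addn0 // -iterSr.
have -> : gap_sum (visits t + returned (sigma (iter t (@sigma _) A))) =
    gap_sum (visits t) + returned (sigma (iter t (@sigma _) A)) * gap (iter t (@sigma _) A) ord0.
  rewrite gap_t; case: (returned _); last by rewrite !addn0.
  by rewrite addn1 mul1n /gap_sum big_ord_recr.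
lia.
Qed.

(** The closing pair is a cyclic descent, so this gap is the first letter plus the positive number
    [n.+1 - C ord_max]. *)
Lemma first_lt_gap (C : 'S_n.+1) : C ord0 < C ord_max -> C ord0 < gap C ord0.
Proof.
rewrite /gap /cyc_dist ord_pred0; have := ltn_ord (C ord_max); case: ifP; lia.
Qed.

(** The intervals from [gap_sum r] to [gap_sum r.+1], right end excluded, are disjoint. The number
    [T + A ord0] lies in the one for [r = visits T] by the clock identity, and in the one for
    [r = n.+1] because [gap_sum n.+1 = T]. *)
Lemma visits_window : visits (n.+1 * cyc_descents A) = n.+1.
Proof.
set T := _ * _.
have [mT _ gapT timeT] := iter_sigma_minus T.
have fullE : gap_sum n.+1 = T by rewrite /gap_sum (sum_iter_ord_pred ord0 (gap A)) sum_gap.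
have gap_sumS r : gap_sum r.+1 = gap_sum r + gap A (iter r (@ord_pred _) ord0).
  by rewrite /gap_sum big_ord_recr.
have gap_sum_mono r1 r2 : r1 <= r2 -> gap_sum r1 <= gap_sum r2.
  by move/subnK <-; elim: (r2 - r1) => // i IHi; rewrite addSn gap_sumS; lia.
have lt1 := first_lt_gap mT; rewrite gapT in lt1.
have lt2 := first_lt_gap A_minus.
have := gap_sumS (visits T); have := gap_sumS n.+1; rewrite iter_ord_pred_id => S1 S2.
case: (ltngtP (visits T) n.+1) => // /gap_sum_mono; lia.
Qed.

(** In this time the values are shifted by a multiple of [n.+1] and the positions rotated [n.+1]
    times; both have no effect. *)
Lemma sigma_window : iter (n.+1 * cyc_descents A) (@sigma _) A = A.
Proof.
have [_ permT _ _] := iter_sigma_minus (n.+1 * cyc_descents A).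
apply/permP => j; rewrite permT visits_window.
by rewrite iter_ordS_muln iter_ord_pred_id.
Qed.

End Window.
End Minus.

(** * Invariance of parity in odd length *)

Definition cycle_perm n : 'S_n := perm (@ordS_inj n).

(** The [n]-th power of the cycle is 1, which for odd [n] forces an even sign. *)
Lemma cycle_perm_even n : odd n -> cycle_perm n = false :> bool.
Proof.
move=> n_odd; have cX t j : (cycle_perm n ^+ t)%g j = iter t (@ordS n) j.
  elim: t j => [|t IHt] j; first by rewrite perm1.
  by rewrite expgSr permM IHt permE.
have c1 : (cycle_perm n ^+ n = 1)%g.
  by apply/permP => j; rewrite cX perm1 -[RHS](iter_ordS_muln _ 1) muln1.
have oddX t : (cycle_perm n ^+ t)%g = odd t && cycle_perm n :> bool.
  elim: t => [|t IHt]; first by rewrite odd_perm1.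
  by rewrite expgSr odd_permM IHt /=; case: (odd t); case: (odd_perm _).
by have := oddX n; rewrite c1 odd_perm1 n_odd.
Qed.

Lemma odd_sigma n (A : 'S_n) : odd n -> sigma A = A :> bool.
Proof.
move=> n_odd; have c_even := cycle_perm_even n_odd.
(* [C] is the rotation of positions, applied before [A]: the cycle, its inverse or 1 according to
   the branch of [sigma_fun]. *)
have [C C_even ->] : exists2 C : 'S_n, C = false :> bool & sigma A = (C * A * cycle_perm n)%g.
  case a1: (letter A 1 == n).
    by exists (cycle_perm n) => //; apply/permP => j; rewrite !permM sigmaE /sigma_fun a1 !permE.
  case an: (letter A n == n).
    exists (cycle_perm n)^-1%g; first by rewrite odd_permV.
    apply/permP => j; rewrite !permM sigmaE /sigma_fun a1 an [RHS]permE; congr (ordS (A _)).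
    by apply: (@perm_inj _ (cycle_perm n)); rewrite permKV permE ord_predK.
  exists 1%g; first exact: odd_perm1.
  by apply/permP => j; rewrite !permM sigmaE /sigma_fun a1 an !permE.
by rewrite !odd_permM C_even c_even addbF.
Qed.

(** * Reversal, and words whose first letter is above the last *)

Definition rev_perm n (A : 'S_n) : 'S_n := (perm rev_ord_inj * A)%g.

Lemma rev_permE n (A : 'S_n) j : rev_perm A j = A (rev_ord j).
Proof. by rewrite permM permE. Qed.

Lemma rev_ord0 n : rev_ord (@ord0 n) = ord_max.
Proof. by apply: val_inj; rewrite /= subn1. Qed.

Lemma rev_ord_max n : rev_ord (@ord_max n) = ord0.
Proof. by rewrite -rev_ord0 rev_ordK. Qed.

Lemma rev_ordS n (j : 'I_n) : rev_ord (ordS j) = ord_pred (rev_ord j).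
Proof.
apply: (can_inj (@ordSK _)); rewrite ord_predK; apply: val_inj => /=.
have := ltn_ord j; rewrite leq_eqVlt => /orP[/eqP jn|jn].
  by rewrite jn modnn subnn subn1 prednK ?modnn //; lia.
by rewrite (modn_small jn) modn_small; lia.
Qed.

Lemma rev_ord_pred n (j : 'I_n) : rev_ord (ord_pred j) = ordS (rev_ord j).
Proof. by rewrite -{2}(ord_predK j) rev_ordS ord_predK. Qed.

(** Reversal exchanges the branches for a maximal first and a maximal last letter; for positive [n]
    the ends are distinct positions, so the two conditions exclude each other. *)
Lemma sigma_rev_perm n (A : 'S_n.+1) : 0 < n -> sigma (rev_perm A) = rev_perm (sigma A).
Proof.
move=> n_gt0; apply/permP => j; rewrite rev_permE !sigmaE /sigma_fun.
rewrite !letter_first !letter_last !rev_permE rev_ord0 rev_ord_max rev_ordS rev_ord_pred.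
case: eqP => [[Am]|_]; case: eqP => [[A0]|_] //.
have /perm_inj/(congr1 val) /= : A ord0 = A ord_max by apply: val_inj; rewrite /= A0 Am.
lia.
Qed.

(** An adjacent pair is an ascent in exactly one of a word and its reversal. *)
Lemma ascents_rev_perm n (A : 'S_n.+1) : ascents (rev_perm A) + ascents A = n.
Proof.
rewrite !ascentsE (reindex_inj rev_ord_inj) -big_split /= -[RHS]card_ord -sum1_card.
apply: eq_bigr => i _; rewrite !rev_permE.
have -> : rev_ord (widen_ord (leqnSn n) (rev_ord i)) = lift ord0 i.
  by apply: val_inj; rewrite /= /bump /=; have := ltn_ord i; lia.
have -> : rev_ord (lift ord0 (rev_ord i)) = widen_ord (leqnSn n) i.
  by apply: val_inj; rewrite /= /bump /=; have := ltn_ord i; lia.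
have : A (widen_ord (leqnSn n) i) != A (lift ord0 i).
  by rewrite (inj_eq perm_inj) -val_eqE /= /bump; lia.
rewrite -val_eqE /=; lia.
Qed.

Section Plus.
Variables (n : nat) (n_gt0 : 0 < n) (A : 'S_n.+1) (A_plus : A ord_max < A ord0).

Let rev_minus : rev_perm A ord0 < rev_perm A ord_max.
Proof. by rewrite !rev_permE rev_ord0 rev_ord_max. Qed.

Lemma sigma_plus : sigma A ord_max < sigma A ord0.
Proof.
have [+ _ _] := sigma_minus n_gt0 rev_minus.
by rewrite sigma_rev_perm // !rev_permE rev_ord0 rev_ord_max.
Qed.

Lemma ascents_sigma_plus : ascents (sigma A) = ascents A.
Proof.
have := ascents_sigma_minus n_gt0 rev_minus; rewrite sigma_rev_perm // => asE.
by apply/eqP; rewrite -(eqn_add2l (ascents (rev_perm A))) -{1}asE !ascents_rev_perm.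
Qed.

Lemma iter_sigma_rev_perm t :
  iter t (@sigma _) (rev_perm A) = rev_perm (iter t (@sigma _) A).
Proof. by elim: t => //= t ->; rewrite sigma_rev_perm. Qed.

(** With [k] ascents in [A], the reversal has [n - k] ascents, hence [n.+1 - (n - k)] cyclic
    descents: this is the source of the factor [k + 1]. *)
Lemma cyc_descents_rev_perm : cyc_descents (rev_perm A) = ascents A + 1.
Proof.
have := cyc_descentsE (rev_perm A); rewrite rev_minus.
have := ascents_rev_perm A; lia.
Qed.

Lemma sigma_window_plus : iter (n.+1 * (ascents A + 1)) (@sigma _) A = A.
Proof.
have := sigma_window n_gt0 rev_minus.
by rewrite cyc_descents_rev_perm iter_sigma_rev_perm => /mulgI.
Qed.

(** Reversal turns a leading 1 into a trailing 1, so the visits are now to words ending in 1. *)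
Lemma visits_window_plus :
  \sum_(t < n.+1 * (ascents A + 1)) (iter t.+1 (@sigma _) A ord_max == ord0) = n.+1.
Proof.
rewrite -[RHS](visits_window n_gt0 rev_minus) cyc_descents_rev_perm.
apply: eq_bigr => t _.
by rewrite iter_sigma_rev_perm /returned rev_permE rev_ord0.
Qed.

End Plus.

(** * Assembly of the three identities *)

Lemma cyc_descents_minus n k (A : 'S_n.+1) :
  A \in Ee_minus n.+1 k -> cyc_descents A = n.+1 - k.
Proof.
rewrite Ee_minusE in_Ee => /andP[/andP[/eqP asA _] A0m].
by have := cyc_descentsE A; rewrite asA A0m; lia.
Qed.

Lemma sigma_Ee_minus n k (A : 'S_n.+1) : 0 < n -> odd n.+1 ->
  A \in Ee_minus n.+1 k -> sigma A \in Ee_minus n.+1 k.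
Proof.
move=> n_gt0 n_odd; rewrite !Ee_minusE !in_Ee odd_sigma // => /andP[/andP[asA ->] A0m].
by have [-> _ _] := sigma_minus n_gt0 A0m; rewrite ascents_sigma_minus // asA.
Qed.

Lemma sigma_Ee_plus n k (A : 'S_n.+1) : 0 < n -> odd n.+1 ->
  A \in Ee_plus n.+1 k -> sigma A \in Ee_plus n.+1 k.
Proof.
move=> n_gt0 n_odd; rewrite !Ee_plusE !in_Ee odd_sigma // => /andP[/andP[asA ->] A0m].
by rewrite sigma_plus // ascents_sigma_plus // asA.
Qed.

Lemma card_Ee_split n k : 0 < n ->
  B n.+1 k = #|Ee_minus n.+1 k| + #|Ee_plus n.+1 k|.
Proof.
move=> n_gt0; rewrite /B -(cardsID [set A : 'S_n.+1 | A ord0 < A ord_max]).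
congr (_ + _); apply: eq_card => A; rewrite ?Ee_minusE ?Ee_plusE !inE odd_inv //.
rewrite andbC -leqNgt leq_eqVlt; congr (_ && _).
by case: eqP => // /val_inj/perm_inj/(congr1 val) /= n0; lia.
Qed.

Theorem theorem3p1 (n k : nat) (n_odd : odd n) (k_range : 1 <= k <= n - 1) :
  [/\ B (n - 1) (k - 1) = \sum_(d <- divisors n) d * alpha n k d,
      B (n - 1) k = \sum_(d <- divisors n) d * beta n k d
    & B n k = \sum_(d <- divisors n)
                d * ((n - k) * alpha n k d + (k + 1) * beta n k d)].
Proof.
(* Length 1 admits no [k]; from here on the length is [n.+2]. *)
case: n n_odd k_range => [|[|n]] // n_odd /andP[k_gt0 k_le]; first by lia.
rewrite subSS subn0 in k_le; rewrite [n.+2 - 1]subSS subn0.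
have m_gt0 : 0 < n.+2 - k by lia.
have plus_window A : A \in Ee_plus n.+2 k -> ascents A = k /\ A ord_max < A ord0.
  by rewrite Ee_plusE in_Ee => /andP[/andP[/eqP]].
have minus_window A : A \in Ee_minus n.+2 k -> iter (n.+2 * (n.+2 - k)) (@sigma _) A = A.
  move=> AX; rewrite -(cyc_descents_minus AX) sigma_window //.
  by move: AX; rewrite Ee_minusE => /andP[].
have minus_visits A : A \in Ee_minus n.+2 k ->
    \sum_(t < n.+2 * (n.+2 - k)) returned (iter t.+1 (@sigma _) A) = n.+2.
  move=> AX; rewrite -(cyc_descents_minus AX); apply: visits_window => //.
  by move: AX; rewrite Ee_minusE => /andP[].
have plus_iter A : A \in Ee_plus n.+2 k -> iter (n.+2 * (k + 1)) (@sigma _) A = A.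
  by case/plus_window => <-; apply: sigma_window_plus.
have plus_visits A : A \in Ee_plus n.+2 k ->
    \sum_(t < n.+2 * (k + 1)) (iter t.+1 (@sigma _) A ord_max == ord0) = n.+2.
  by case/plus_window => <-; apply: visits_window_plus.
have k1_gt0 : 0 < k + 1 by rewrite addn1.
have minus_stable A : A \in Ee_minus n.+2 k -> sigma A \in Ee_minus n.+2 k.
  exact: sigma_Ee_minus.
have plus_stable A : A \in Ee_plus n.+2 k -> sigma A \in Ee_plus n.+2 k.
  exact: sigma_Ee_plus.
split.
(* Hits are the words starting with 1, in a window of [n.+2] times [n.+2 - k] steps. *)
- rewrite -card_Ee_minus_canonical //.
  exact: (card_hits_orbits (ltn0Sn _) m_gt0 minus_stable minus_window minus_visits).
(* Hits are the words ending in 1; the odd length [n.+2] makes [n.+1] even. *)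
- rewrite -card_Ee_plus_canonical; last by move: n_odd.
  exact: (card_hits_orbits (H := fun A => A ord_max == ord0)
            (ltn0Sn _) k1_gt0 plus_stable plus_iter plus_visits).
(* All words are now counted: an orbit with [d] hits has [d * (n.+2 - k)] or [d * (k + 1)]
   elements. *)
rewrite card_Ee_split //.
rewrite (card_orbits (ltn0Sn _) m_gt0 minus_stable minus_window minus_visits) //.
rewrite (card_orbits (H := fun A => A ord_max == ord0)
           (ltn0Sn _) k1_gt0 plus_stable plus_iter plus_visits) //.
by rewrite -big_split; apply: eq_bigr => d _; rewrite [RHS]mulnDr.
Qed.
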